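(* Let $q\ge2$ be an integer, let $\{X_n\}_{n\ge1}$ be a stationary stochastic process with state space $\{0,\ldots,q-1\}$, let $F$ be the cumulative distribution function of $X=\sum_{n=1}^\infty X_nq^{-n}$, and let $x\in[0,1]$. Then $F$ is strictly increasing at $x$ if and only if for all $n\in\mathbb N$: - if $x=(0.x_1x_2\ldots)_q\notin\mathbb Q_q$, then $p(x_1,\ldots,x_n)>0$; - if $x=(0.x_1\ldots x_m00\ldots)_q\in\mathbb Q_q$ is of order $m$, then $$p(x_1,\ldots,x_m,\underbrace{0,\ldots,0}_{n\text{ zeros}})+p(x_1,\ldots,x_{m-1},x_m-1,\underbrace{q-1,\ldots,q-1}_{n\ (q-1)\text{'s}})>0.$$ In particular, $F$ is strictly increasing on $[0,1]$ if $p(x_1,\ldots,x_n)>0$ for all $n\in\mathbb N$ and all $x_1,\ldots,x_n\in\{0,\ldots,q-1\}$.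
   Context: $\mathbb N=\{1,2,\ldots\}$. Stationary means that $\{X_n\}_{n\ge1}$ and $\{X_n\}_{n\ge2}$ are identically distributed. $F(x)=\mathrm P(X\le x)$ for $x\in\mathbb R$. For $x\in[0,1]$, $F$ is said to be strictly increasing at $x$ if $F(s)<F(t)$ whenever $s<x<t$. For digits $x_n\in\{0,\ldots,q-1\}$, $(0.x_1x_2\ldots)_q=\sum_{n=1}^\infty x_nq^{-n}$, and $p(x_1,\ldots,x_n)=\mathrm P(X_1=x_1,\ldots,X_n=x_n)$. $\mathbb Q_q$ is the set of base-$q$ fractions in $(0,1)$, i.e. numbers $(0.x_1\ldots x_m00\ldots)_q$ with $m\in\mathbb N$ and $x_m>0$; this $m$ is called the order of $x$. Every $x\in[0,1]\setminus\mathbb Q_q$ has a unique base-$q$ expansion. *)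

(* Defs.v *)
From HB Require Import structures.
From mathcomp Require Import all_boot all_order all_algebra.
From mathcomp Require Import all_classical all_reals all_analysis.
From mathcomp Require Import measurable_realfun.

Set Implicit Arguments.
Unset Strict Implicit.
Unset Printing Implicit Defensive.

Import Order.TTheory GRing.Theory Num.Theory.
Import numFieldNormedType.Exports.

Local Open Scope classical_set_scope.
Local Open Scope ring_scope.

(* Indices start at 0 throughout: a sequence x : nat -> _ has x 0 as its first
   digit (x_1 in the usual notation), and X 0 is the first variable of a
   process. *)

(* (0.x_1 x_2 ...)_q *)
Definition base_real (R : realType) (q : nat) (x : nat -> nat) : R :=
  limn (series (fun n => (x n)%:R / q%:R ^+ n.+1 : R)).

(* x = (0.w_1 ... w_m 0 0 ...)_q with m = size w and w_m > 0: the word w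
   witnesses that x is a base-q fraction of order size w.  The default values
   of nth and last supply the trailing zeros and force w to be nonempty. *)
Definition is_base_fraction (R : realType) (q : nat) (x : R) (w : seq nat) :=
  [/\ all (fun a => a < q)%N w, (0 < last 0 w)%N & x = base_real R q (nth 0%N w)].

(* The set Q_q of base-q fractions in (0,1). *)
Definition base_fractions (R : realType) (q : nat) : set R :=
  [set x | exists w, is_base_fraction q x w].

Definition strictly_increasing_at (R : realType) (F : R -> \bar R) (x : R) :=
  forall s t : R, s < x -> x < t -> (F s < F t)%E.

(* The product sigma-algebra on the space of sequences over nat, which carries
   the discrete sigma-algebra. *)
Definition measurable_seq : set (set (nat -> nat)) :=
  <<s \bigcup_n preimage_set_system [set: nat -> nat] (fun w => w n) measurable >>.

Section process.
Context (d : measure_display) (T : measurableType d) (R : realType).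
Context (P : probability T R).
Implicit Type X : nat -> {RV P >-> nat}.

(* Equality of the laws of two processes on the sequence space. *)
Definition identically_distributed X Y :=
  forall A, measurable_seq A ->
    P [set t | A (fun n => X n t)] = P [set t | A (fun n => Y n t)].

Definition stationary X := identically_distributed X (fun n => X n.+1).

(* p(w_1, ..., w_n) with n = size w *)
Definition word_prob X (w : seq nat) : \bar R :=
  P [set t | mkseq (fun i => X i t) (size w) = w].

Definition base_sum (q : nat) X (t : T) : R := base_real R q (fun n => X n t).

Lemma measurable_base_sum q X : measurable_fun setT (base_sum q X).
Proof.
pose f n (t : T) : R := (X n t)%:R / q%:R ^+ n.+1.
have f0 n t : 0 <= f n t by rewrite /f divr_ge0 ?exprn_ge0 ?ler0n.
have mf n : measurable_fun setT (f n).
  by apply: (measurableT_comp (f := fun j : nat => j%:R / q%:R ^+ n.+1 : R)).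
have -> : base_sum q X = fun t => fine (\sum_(0 <= n <oo) (f n t)%:E)%E.
  apply/funext => t; rewrite /base_sum /base_real.
  have [cf|ncf] := pselect (cvgn (series (f ^~ t))).
    have -> : (\sum_(0 <= n <oo) (f n t)%:E)%E = (limn (series (f ^~ t)))%:E.
      rewrite -EFin_lim//; congr (limn _); apply/funext => n /=.
      by rewrite /series/= sumEFin.
    by [].
  rewrite (dvgP ncf).
  have -> : (\sum_(0 <= n <oo) (f n t)%:E)%E = +oo%E.
    apply/cvg_lim => //.
    have -> : (fun n => \sum_(0 <= k < n) (f k t)%:E)%E = EFin \o series (f ^~ t).
      by apply/funext => n /=; rewrite /series/= sumEFin.
    apply/cvgeryP; apply: nondecreasing_dvgn_lt => //.
    by apply/nondecreasing_seqP => n; rewrite seriesSr lerDl f0.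
  by [].
apply: (measurableT_comp (f := fine)) => //.
apply: ge0_emeasurable_sum => // n; last first.
  by move=> _; apply/measurable_EFinP; exact: mf.
by move=> t _ _; rewrite lee_fin f0.
Qed.

HB.instance Definition _ q X :=
  isMeasurableFun.Build _ _ T R (base_sum q X) (measurable_base_sum q X).

End process.

(* Main.v *)
Require Import Defs.
From HB Require Import structures.
From mathcomp Require Import all_boot all_order all_algebra.
From mathcomp Require Import all_classical all_reals all_analysis.
From mathcomp Require Import zify lra.

Set Implicit Arguments.
Unset Strict Implicit.
Unset Printing Implicit Defensive.

Import Order.TTheory GRing.Theory Num.Theory.
Import numFieldNormedType.Exports.

Local Open Scope classical_set_scope.
Local Open Scope ring_scope.

(* Writing N for the integer with base-q digits x_1 ... x_n, the number
   x = (0.x_1x_2...)_q lies in [N/q^n, (N+1)/q^n], and a number strictly inside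
   this interval has first digits x_1 ... x_n.  Hence a cylinder of positive
   probability forces F to grow across its interval, while growth of F across
   a small interval around x gives positive probability to the cylinders whose
   interval meets it: one cylinder if x is not a base-q fraction, two if it is
   (the endpoints 0 and 1 being covered by F(s) = 0 for s < 0 and F(t) = 1 for
   t > 1). *)

(** * Digit words as integers written in base [q] *)

Definition word_val (q : nat) (w : seq nat) : nat :=
  foldl (fun k a => k * q + a)%N 0%N w.

Lemma word_val_rcons q w a : word_val q (rcons w a) = (word_val q w * q + a)%N.
Proof. by rewrite /word_val foldl_rcons. Qed.

Lemma word_val_cat_zeros q w n :
  word_val q (w ++ nseq n 0%N) = (word_val q w * q ^ n)%N.
Proof.
elim: n => [|n IH]; first by rewrite cats0 expn0 muln1.
have -> : nseq n.+1 0%N = rcons (nseq n 0%N) 0%N by rewrite -cats1 -(nseqD n 1) addn1.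
by rewrite -rcons_cat word_val_rcons IH addn0 expnSr mulnA.
Qed.

(** Top digits appended to [w] stop one short of the multiple of [q ^ n] where the next block
    begins. This makes the two words attached to a base-[q] fraction consecutive integers. *)
Lemma word_val_cat_top q w n : (0 < q)%N ->
  (word_val q (w ++ nseq n q.-1)).+1 = ((word_val q w).+1 * q ^ n)%N.
Proof.
move=> q0; elim: n => [|n IH]; first by rewrite cats0 expn0 muln1.
have -> : nseq n.+1 q.-1 = rcons (nseq n q.-1) q.-1 by rewrite -cats1 -(nseqD n 1) addn1.
rewrite -rcons_cat word_val_rcons expnSr mulnA -IH; nia.
Qed.

Lemma word_val_lt q w : all (fun a => a < q)%N w -> (word_val q w < q ^ size w)%N.
Proof.
elim/last_ind: w => // w a IH; rewrite all_rcons => /andP[aq /IH {}IH].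
rewrite word_val_rcons size_rcons expnSr; nia.
Qed.

(** The last digit is the residue modulo [q], and the quotient is the value of the rest. This lets
    integer bounds on a truncation identify the word itself. *)
Lemma word_val_inj q w w' : size w = size w' ->
  all (fun a => a < q)%N w -> all (fun a => a < q)%N w' ->
  word_val q w = word_val q w' -> w = w'.
Proof.
elim/last_ind: w w' => [|w a IH] w'; first by case: w'.
case/lastP: w' => [|w' a']; first by rewrite size_rcons.
rewrite !size_rcons !all_rcons !word_val_rcons => -[ss] /andP[aq aw] /andP[aq' aw'] e.
have eqa : a = a' by have := congr1 (modn^~ q) e; rewrite /= !modnMDl !modn_small.
rewrite eqa in e *; congr rcons; apply: IH => //.
by move/addIn: e => /eqP; rewrite eqn_pmul2r ?(leq_trans _ aq)// => /eqP.
Qed.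

Lemma all_mkseq_lt q (x : nat -> nat) n : (forall i, x i < q)%N ->
  all (fun a => a < q)%N (mkseq x n).
Proof. by move=> xq; apply/allP => _ /mapP[i _ ->]. Qed.

Lemma word_val_surj q n k : (0 < q)%N -> (k < q ^ n)%N ->
  exists w, [/\ size w = n, all (fun a => a < q)%N w & word_val q w = k].
Proof.
move=> q0; elim: n k => [|n IH] k kq.
  by exists [::]; split => //; move: kq; rewrite expn0; case: k.
have [|w [sw aw wk]] := IH (k %/ q)%N; first by rewrite ltn_divLR// -expnSr.
exists (rcons w (k %% q)%N); split; first by rewrite size_rcons sw.
  by rewrite all_rcons aw ltn_mod q0.
by rewrite word_val_rcons wk -divn_eq.
Qed.

(** * Base-[q] expansions of real numbers *)

Section digit_expansions.
Context (R : realType) (q : nat).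
Hypothesis q2 : (2 <= q)%N.
Implicit Types (x : nat -> nat) (w : seq nat).

Let q0 : (0 < q)%N. Proof. exact: leq_trans q2. Qed.

Let qn0 n : 0 < q%:R ^+ n :> R. Proof. by rewrite exprn_gt0// ltr0n. Qed.

Lemma series_digits x n :
  series (fun i => (x i)%:R / q%:R ^+ i.+1 : R) n =
  (word_val q (mkseq x n))%:R / q%:R ^+ n.
Proof.
elim: n => [|n IH]; first by rewrite /series/= big_geq// mul0r.
rewrite seriesSr IH mkseqS word_val_rcons natrD natrM exprSr mulrDl.
by rewrite invfM mulrACA divff ?mulr1// pnatr_eq0 -lt0n.
Qed.

Lemma base_real_word w :
  base_real R q (nth 0%N w) = (word_val q w)%:R / q%:R ^+ size w.
Proof.
apply: lim_near_cst => //; near=> n.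
have wn : (size w <= n)%N by near: n; exact: nbhs_infty_ge.
rewrite series_digits.
have -> : mkseq (nth 0%N w) n = w ++ nseq (n - size w) 0%N.
  apply: (@eq_from_nth _ 0%N); first by rewrite size_mkseq size_cat size_nseq subnKC.
  move=> i; rewrite size_mkseq => iN; rewrite nth_mkseq// nth_cat nth_nseq.
  by case: ltnP => // wi; rewrite nth_default// if_same.
rewrite word_val_cat_zeros natrM natrX -{2}(subnKC wn) exprD invfM mulrACA.
by rewrite divff ?mulr1// gt_eqF.
Unshelve. all: by end_near. Qed.

(** The left endpoints increase with the length and the right endpoints decrease, since a digit plus
    one is at most [q]. So every partial sum is below every right endpoint, which gives both the
    convergence of the series and the bounds on its limit. *)
Lemma base_real_bounds x n : (forall i, x i < q)%N ->
  (word_val q (mkseq x n))%:R <= base_real R q x * q%:R ^+ n <=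
  (word_val q (mkseq x n)).+1%:R.
Proof.
move=> xq; set u := series (fun i => (x i)%:R / q%:R ^+ i.+1 : R).
have uE m : u m = (word_val q (mkseq x m))%:R / q%:R ^+ m by exact: series_digits.
have nd : nondecreasing_seq u.
  apply/nondecreasing_seqP => m; rewrite /u seriesSr lerDl.
  by rewrite divr_ge0 ?exprn_ge0 ?ler0n.
have ni : nonincreasing_seq (fun m => (word_val q (mkseq x m)).+1%:R / q%:R ^+ m : R).
  apply/nonincreasing_seqP => m.
  rewrite ler_pdivrMr// exprS mulrCA -mulrA mulrCA mulVf ?mulr1 ?gt_eqF//.
  rewrite -natrM ler_nat mkseqS word_val_rcons.
  have := xq m; nia.
have ub m k : u m <= (word_val q (mkseq x k)).+1%:R / q%:R ^+ k.
  apply: (le_trans (nd _ _ (leq_maxl m k))).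
  apply: (le_trans _ (ni _ _ (leq_maxr m k))).
  by rewrite uE ler_pM2r ?invr_gt0// ler_nat.
have cu : cvgn u.
  apply: nondecreasing_is_cvgn => //.
  by exists ((word_val q (mkseq x 0)).+1%:R / q%:R ^+ 0) => _ [m _ <-]; exact: ub.
have -> : base_real R q x = limn u by [].
apply/andP; split; first by rewrite -ler_pdivrMr// -uE nondecreasing_cvgn_le.
by rewrite -ler_pdivlMr//; apply: limr_le => //; exact: nearW.
Qed.

(** Strictness matters: if the scaled number equals [k], an expansion ending in digits [q - 1] has
    truncation [k - 1]. *)
Lemma word_val_mkseq_ge x n k : (forall i, x i < q)%N ->
  k%:R < base_real R q x * q%:R ^+ n -> (k <= word_val q (mkseq x n))%N.
Proof.
move=> xq kx; have /andP[_] := base_real_bounds n xq.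
by move=> /(lt_le_trans kx); rewrite ltr_nat ltnS.
Qed.

Lemma word_val_mkseq_le x n k : (forall i, x i < q)%N ->
  base_real R q x * q%:R ^+ n < k.+1%:R -> (word_val q (mkseq x n) <= k)%N.
Proof.
move=> xq kx; have /andP[+ _] := base_real_bounds n xq.
by move=> /le_lt_trans/(_ kx); rewrite ltr_nat ltnS.
Qed.

Lemma exists_expn_inv_lt (e : R) : 0 < e -> exists2 n, (0 < n)%N & 1 < e * q%:R ^+ n.
Proof.
(* This [n] exceeds [e^-1], and [n < q ^ n]. *)
move=> e0; exists (Num.truncn e^-1).+1 => //.
rewrite mulrC -ltr_pdivrMr// div1r; apply: (lt_le_trans (truncnS_gt _)).
by rewrite -natrX ler_nat ltnW// ltn_expl.
Qed.

(** The bound is uniform in [m] because at a fraction the relevant words are longer than the number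
    [n] of appended digits. *)
Lemma exists_expn_separating (s x t : R) : s < x -> x < t ->
  exists2 n, (0 < n)%N & forall m, (n <= m)%N ->
    1 < (x - s) * q%:R ^+ m /\ 1 < (t - x) * q%:R ^+ m.
Proof.
move=> sx xt; have e0 : 0 < Num.min (x - s) (t - x) by rewrite lt_min !subr_gt0 sx.
have [n n0 en] := exists_expn_inv_lt e0; exists n => // m nm.
have {}en : 1 < Num.min (x - s) (t - x) * q%:R ^+ m.
  by apply: (lt_le_trans en); rewrite ler_pM2l// ler_weXn2l ?ler1n.
split; apply: (lt_le_trans en); rewrite ler_pM2r// ge_min lexx ?orbT//.
Qed.

(** For every [n] both numbers lie in the same interval of length [q ^- n]. *)
Lemma base_real_eq x (y : R) : (forall i, x i < q)%N ->
  (forall n, (word_val q (mkseq x n))%:R <= y * q%:R ^+ n <=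
             (word_val q (mkseq x n)).+1%:R) ->
  y = base_real R q x.
Proof.
move=> xq yb; case: (ltgtP y (base_real R q x)) => //; rewrite -subr_gt0.
  move=> /exists_expn_inv_lt[n _]; have := base_real_bounds n xq; have := yb n.
  by rewrite -natr1; lra.
move=> /exists_expn_inv_lt[n _]; have := base_real_bounds n xq; have := yb n.
by rewrite -natr1; lra.
Qed.

(** Compatible integer approximations [k] are the truncations of an expansion whose digits are the
    residues of [k n.+1] modulo [q]. Leaving [k] free covers both floors and the all-top expansion
    of 1. *)
Lemma base_real_digits_of_approx (k : nat -> nat) (y : R) : k 0%N = 0%N ->
  (forall n, k n.+1 %/ q = k n)%N ->
  (forall n, (k n)%:R <= y * q%:R ^+ n <= (k n).+1%:R) ->
  exists2 x, (forall i, x i < q)%N & y = base_real R q x.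
Proof.
move=> k0 kS yk; pose x n := (k n.+1 %% q)%N.
have xq i : (x i < q)%N by rewrite ltn_mod.
exists x => //; apply: base_real_eq => // n.
suff -> : word_val q (mkseq x n) = k n by exact: yk.
elim: n => [|n IH]; first by rewrite k0.
by rewrite mkseqS word_val_rcons IH -kS -divn_eq.
Qed.

Lemma base_real_surj (y : R) : 0 <= y <= 1 ->
  exists2 x, (forall i, x i < q)%N & y = base_real R q x.
Proof.
move=> /andP[y0]; rewrite le_eqVlt => /predU1P[->|y1].
  (* For [y = 1] the floor [q ^ n] would violate [k 0 = 0]; one less gives the expansion with all
     digits [q - 1]. *)
  apply: (@base_real_digits_of_approx (fun n => (q ^ n).-1)) => // n.
    have := expn_gt0 q n; rewrite q0 expnS /= => qn.
    have -> : ((q * q ^ n).-1 = (q ^ n).-1 * q + q.-1)%N by nia.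
    by rewrite divnMDl// divn_small ?addn0// ltn_predL.
  by rewrite mul1r -natrX !ler_nat leq_pred leqSpred.
have yn n : 0 <= y * q%:R ^+ n by rewrite mulr_ge0// ltW.
apply: (@base_real_digits_of_approx (fun n => Num.truncn (y * q%:R ^+ n))) => [|n|n].
- by apply: truncn_def; rewrite expr0 mulr1 y0.
- apply/esym/truncn_def.
  have /andP[tl tu] := truncn_itv (yn n.+1).
  move: tl tu; set t := Num.truncn _ => tl tu.
  have qR : 0 < q%:R :> R by rewrite ltr0n.
  rewrite exprSr mulrA in tl tu; apply/andP; split.
    rewrite -(ler_pM2r qR) (le_trans _ tl)// -natrM ler_nat; exact: leq_divM.
  rewrite -(ltr_pM2r qR) (lt_le_trans tu)// -natrM ler_nat; exact: ltn_ceil.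
- by have /andP[-> /ltW ->] := truncn_itv (yn n).
Qed.

(** A witness must end in a nonzero digit, so factors [q] common to [k] and the denominator are
    cancelled first. *)
Lemma base_fractions_div n k : (0 < k)%N -> (k < q ^ n)%N ->
  base_fractions q (k%:R / q%:R ^+ n : R).
Proof.
elim: n k => [|n IH] k k0 kn; first by move: kn; rewrite expn0 ltnNge k0.
have [/eqP qk|qk] := eqVneq (k %% q)%N 0%N.
  have kE : k = (k %/ q * q)%N by rewrite divnK.
  rewrite [X in X%:R]kE natrM exprSr invfM mulrACA divff ?mulr1; last first.
    by rewrite pnatr_eq0 -lt0n.
  by apply: IH; [nia | rewrite ltn_divLR// -expnSr].
have [w [sw aw wk]] := word_val_surj q0 kn.
exists w; split => //; last by rewrite base_real_word wk sw.
case/lastP: w sw aw wk => // w a _; rewrite all_rcons last_rcons => /andP[aq _] wk.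
by rewrite lt0n; apply: contra qk => /eqP a0; rewrite -wk word_val_rcons a0 addn0 modnMl.
Qed.

(** These words begin the two expansions of [x]: their intervals are adjacent, and [x] is the left
    endpoint for [w0] and the right endpoint for [w1]. *)
Lemma base_fraction_words (x : R) u a n : is_base_fraction q x (rcons u a) ->
  let w0 := rcons u a ++ nseq n 0%N in
  let w1 := rcons u a.-1 ++ nseq n q.-1 in
  [/\ size w1 = size w0, all (fun b => b < q)%N w0, all (fun b => b < q)%N w1,
      word_val q w0 = (word_val q w1).+1 &
      x * q%:R ^+ size w0 = (word_val q w0)%:R].
Proof.
move=> [+ + xE] w0 w1; rewrite last_rcons all_rcons => /andP[aq uq] a0.
rewrite /w0 /w1; split.
- by rewrite !size_cat !size_rcons !size_nseq.
- by rewrite all_cat all_rcons aq uq all_nseq q0 orbT.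
- by rewrite all_cat all_rcons uq all_nseq !ltn_predL q0 orbT (leq_ltn_trans (leq_pred a)).
- rewrite word_val_cat_zeros word_val_cat_top// !word_val_rcons.
  by rewrite -addnS prednK.
- rewrite xE base_real_word// word_val_cat_zeros size_cat size_nseq natrM natrX.
  by rewrite exprD mulrA divfK// gt_eqF.
Qed.

End digit_expansions.

(** * Cylinder events and increments of a distribution function *)

Section probability_lemmas.
Context (d : measure_display) (T : measurableType d) (R : realType).
Context (P : probability T R).
Implicit Types (X : nat -> {RV P >-> nat}) (w : seq nat).

Definition word_event X w : set T := [set t | mkseq (fun i => X i t) (size w) = w].

Lemma measurable_word_event X w : measurable (word_event X w).
Proof.
elim/last_ind: w => [|w a IH].
  by rewrite /word_event [X in measurable X](_ : _ = setT)//; apply/seteqP.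
rewrite [X in measurable X](_ : _ = word_event X w `&` X (size w) @^-1` [set a]).
  by apply: measurableI => //; rewrite -[X in measurable X]setTI;
     exact: (measurable_funPT (X (size w))).
apply/seteqP; rewrite /word_event; split=> t /=; rewrite size_rcons mkseqS.
  by move/rcons_inj => -[].
by move=> [-> ->].
Qed.

(** The event [Y <= t] is covered by [Y <= s] and [B], so a null [B] would leave no increment. *)
Lemma cdf_lt_measure_gt0 (Y : {RV P >-> R}) (B : set T) (s t : R) :
  measurable B -> (forall z, s < Y z <= t -> B z) -> s < t ->
  (cdf Y s < cdf Y t)%E -> (0 < P B)%E.
Proof.
rewrite /cdf /distribution /pushforward => mB YB st Fst; rewrite lt0e measure_ge0 andbT.
apply: contraTneq Fst => PB0; rewrite -leNgt.
have mY r : measurable (Y @^-1` `]-oo, r]).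
  by rewrite -[X in measurable X]setTI; exact: (measurable_funPT Y).
rewrite -[leRHS]adde0 -PB0.
apply: (@le_trans _ _ (P (Y @^-1` `]-oo, s] `|` B))%E); last exact: measureU2.
apply: le_measure; rewrite ?inE//; first exact: measurableU.
move=> z /=; rewrite !in_itv/= => zt; have [zs|sz] := leP (Y z) s; first by left.
by right; apply: YB; rewrite sz.
Qed.

(** Inside [Y <= t], the set [B] is disjoint from [Y <= s], so its mass adds to that of [Y <= s]. *)
Lemma measure_gt0_cdf_lt (Y : {RV P >-> R}) (B : set T) (s t : R) :
  measurable B -> (forall z, B z -> s < Y z <= t) -> s < t ->
  (0 < P B)%E -> (cdf Y s < cdf Y t)%E.
Proof.
rewrite /cdf /distribution /pushforward => mB BY st PB0.
have mY r : measurable (Y @^-1` `]-oo, r]).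
  by rewrite -[X in measurable X]setTI; exact: (measurable_funPT Y).
apply: (@lt_le_trans _ _ (P (Y @^-1` `]-oo, s]) + P B)%E).
  by rewrite lteDl// fin_num_measure.
rewrite -measureU//.
  apply: le_measure; rewrite ?inE//; first exact: measurableU.
  move=> z /= [|/BY/andP[_ Yt]]; rewrite !in_itv//= => /le_trans; apply.
  exact: ltW.
apply/seteqP; split=> z //= [+ /BY/andP[sY _]].
by rewrite in_itv/= leNgt sY.
Qed.

End probability_lemmas.

(** * Cylinder probabilities versus growth of [F] *)

Section digit_process.
Context (d : measure_display) (T : measurableType d) (R : realType).
Context (P : probability T R) (q : nat).
Hypothesis q2 : (2 <= q)%N.
Variable X : nat -> {RV P >-> nat}.
Hypothesis Xq : forall n t, (X n t < q)%N.

Let q0 : (0 < q)%N. Proof. exact: leq_trans q2. Qed.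
Let qn0 n : 0 < q%:R ^+ n :> R. Proof. by rewrite exprn_gt0// ltr0n. Qed.

Let F : R -> \bar R := cdf (base_sum q X : {RV P >-> R}).

(** The increment of [F] is the mass of the half-open interval from [s] (excluded) to [t]
    (included), hence a strict inequality on the left only. *)
Lemma word_prob_gt0_cdf_lt w (s t : R) :
  s * q%:R ^+ size w < (word_val q w)%:R ->
  (word_val q w).+1%:R <= t * q%:R ^+ size w ->
  (0 < word_prob X w)%E -> (F s < F t)%E.
Proof.
move=> sw wt; apply: measure_gt0_cdf_lt; first exact: measurable_word_event.
  move=> z wz; have := base_real_bounds R q2 (size w) (fun n => Xq n z).
  rewrite wz => /andP[wl wu]; apply/andP; split.
    by rewrite -(ltr_pM2r (qn0 (size w))) (lt_le_trans sw).
  by rewrite -(ler_pM2r (qn0 (size w))) (le_trans wu).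
rewrite -(ltr_pM2r (qn0 (size w))) (lt_le_trans sw)// (le_trans _ wt)//.
by rewrite ler_nat.
Qed.

Lemma increasing_nonfraction x xs n : strictly_increasing_at F x ->
  ~ base_fractions q x -> (forall i, xs i < q)%N -> x = base_real R q xs ->
  (0 < word_prob X (mkseq xs n))%E.
Proof.
move=> Fx xQ xsq xE; have := base_real_bounds R q2 n xsq.
have := word_val_lt (all_mkseq_lt n xsq); rewrite -xE size_mkseq.
set k := word_val q _ => kq /andP[kx xk].
(* The natural window is the interval of the truncation, which contains [x] in its interior unless
   [x] is 0 or 1. At the extreme values of [k] any point beyond [x] serves, since truncations stay
   between 0 and [q ^ n - 1]. Otherwise [t] is a midpoint, to stay strictly below the right
   endpoint. *)
pose s := if k == 0%N then x - 1 else k%:R / q%:R ^+ n.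
pose t := if k.+1 == (q ^ n)%N then x + 1 else (x + k.+1%:R / q%:R ^+ n) / 2.
have sx : s < x.
  rewrite /s; case: eqVneq => [_|k0]; first lra.
  rewrite lt_neqAle ler_pdivrMr// kx andbT; apply/eqP => e.
  by apply: xQ; rewrite -e; apply: base_fractions_div; rewrite // lt0n.
have xkn : k.+1 != (q ^ n)%N -> x < k.+1%:R / q%:R ^+ n.
  move=> kn; rewrite lt_neqAle ler_pdivlMr// xk andbT; apply/eqP => e.
  by apply: xQ; rewrite e; apply: base_fractions_div; rewrite // ltn_neqAle kn.
have xt : x < t by rewrite /t; case: eqVneq => [_|/xkn]; lra.
apply: (cdf_lt_measure_gt0 _ _ (lt_trans sx xt) (Fx _ _ sx xt)).
  exact: measurable_word_event.
move=> z /andP[sz zt]; rewrite /word_event/= size_mkseq.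
have Xz i : (X i z < q)%N by [].
apply: (@word_val_inj q); rewrite ?size_mkseq ?all_mkseq_lt//.
apply/eqP; rewrite eqn_leq -/k; apply/andP; split.
  have := word_val_lt (all_mkseq_lt n Xz); rewrite size_mkseq.
  move: zt; rewrite /t; case: eqVneq => [<- _|/xkn xkn' zt _]; first by rewrite ltnS.
  apply: (word_val_mkseq_le (R := R) q2 Xz); rewrite -ltr_pdivlMr//; apply: (le_lt_trans zt).
  lra.
move: sz; rewrite /s; case: eqVneq => [->//|_ sz].
by apply: (word_val_mkseq_ge (R := R) q2 Xz); rewrite -ltr_pdivrMr.
Qed.

Lemma increasing_fraction x u a n : strictly_increasing_at F x ->
  is_base_fraction q x (rcons u a) ->
  (0 < word_prob X (rcons u a ++ nseq n 0%N) +
       word_prob X (rcons u a.-1 ++ nseq n q.-1))%E.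
Proof.
move=> Fx /(base_fraction_words q2 n) /=.
set w1 := _ ++ _; set w0 := _ ++ _ => -[sw wq0 wq1 ww xw].
set N := size w0 in sw xw *; set k := word_val q w1 in ww.
(* Scaled by [q ^ N], [x] is [k + 1] and the two intervals fill [[k, k + 2]]; the bound [k + 3/2]
   keeps the closed end of the window strictly below [k + 2]. *)
have [sx xt] : (k%:R / q%:R ^+ N < x) /\ x < (k%:R + 3 / 2) / q%:R ^+ N.
  by rewrite ltr_pdivrMr// ltr_pdivlMr// xw ww -natr1; split; lra.
have m0 := measurable_word_event X w0; have m1 := measurable_word_event X w1.
apply: (@lt_le_trans _ _ (P (word_event X w0 `|` word_event X w1))); last first.
  exact: measureU2.
apply: (cdf_lt_measure_gt0 _ _ (lt_trans sx xt) (Fx _ _ sx xt)).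
  exact: measurableU.
move=> z /andP[]; rewrite ltr_pdivrMr// ler_pdivlMr// => sz zt.
have Xz i : (X i z < q)%N by [].
have kl := word_val_mkseq_ge q2 Xz sz.
have : (word_val q (mkseq (fun i => X i z) N) <= k.+1)%N.
  by apply: (word_val_mkseq_le (R := R) q2 Xz); apply: (le_lt_trans zt);
     rewrite -[k.+2%:R]natr1 -[k.+1%:R]natr1; lra.
rewrite leq_eqVlt ltnS => /orP[/eqP e|ku]; [left|right]; rewrite /word_event/=.
  by apply: (@word_val_inj q); rewrite ?size_mkseq ?all_mkseq_lt// e ww.
apply: (@word_val_inj q); rewrite ?size_mkseq ?all_mkseq_lt// sw.
by apply/eqP; rewrite eqn_leq ku kl.
Qed.

(** Once [q ^- n] is below both distances from [x] to [s] and [t], the interval of the truncation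
    fits strictly between them. *)
Lemma nonfraction_increasing x xs : (forall i, xs i < q)%N -> x = base_real R q xs ->
  (forall n, (0 < n)%N -> (0 < word_prob X (mkseq xs n))%E) ->
  strictly_increasing_at F x.
Proof.
move=> xsq xE px s t sx xt.
have [n n0 /(_ n (leqnn n))[e1 e2]] := exists_expn_separating q2 sx xt.
have := base_real_bounds R q2 n xsq; rewrite -xE -natr1 => kx.
by apply: (word_prob_gt0_cdf_lt _ _ (px n n0)); rewrite size_mkseq -?natr1; lra.
Qed.

Lemma fraction_increasing x u a : is_base_fraction q x (rcons u a) ->
  (forall n, (0 < n)%N ->
    (0 < word_prob X (rcons u a ++ nseq n 0%N) +
         word_prob X (rcons u a.-1 ++ nseq n q.-1))%E) ->
  strictly_increasing_at F x.
Proof.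
move=> xf px s t sx xt.
have [n n0 en] := exists_expn_separating q2 sx xt.
have [] := base_fraction_words q2 n xf.
set w1 := _ ++ _; set w0 := _ ++ _ => sw _ _ ww xw.
have [|e1 e2] := en (size w0); first by rewrite size_cat size_nseq leq_addl.
have wwR : (word_val q w0)%:R = (word_val q w1)%:R + 1 :> R by rewrite ww natr1.
(* A positive sum has a positive term, and the intervals of both words lie strictly between [s] and
   [t]. *)
have [p0|] := ltP 0%E (word_prob X w0).
  by apply: (word_prob_gt0_cdf_lt _ _ p0); rewrite -?natr1; lra.
move=> p0; have p1 : (0 < word_prob X w1)%E.
  by apply: (lt_le_trans (px n n0)); rewrite -[leRHS]add0e leeD2r.
by apply: (word_prob_gt0_cdf_lt _ _ p1); rewrite sw -?natr1; lra.
Qed.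

End digit_process.

Theorem proposition2p4 (d : measure_display) (T : measurableType d)
    (R : realType) (P : probability T R) (q : nat) (hq : (2 <= q)%N)
    (X : nat -> {RV P >-> nat})
    (hXq : forall n t, (X n t < q)%N) (hX : stationary X) :
  let F : R -> \bar R := cdf (base_sum q X : {RV P >-> R}) in
  (forall x : R, 0 <= x <= 1 ->
    strictly_increasing_at F x <->
    forall n : nat, (0 < n)%N ->
      (~ base_fractions q x ->
        forall xs : nat -> nat, (forall i, xs i < q)%N -> x = base_real R q xs ->
        (0 < word_prob X (mkseq xs n))%E) /\
      (forall (u : seq nat) (a : nat), is_base_fraction q x (rcons u a) ->
        (0 < word_prob X (rcons u a ++ nseq n 0%N) +
             word_prob X (rcons u a.-1 ++ nseq n q.-1))%E)) /\
  ((forall w : seq nat, (0 < size w)%N -> all (fun a => a < q)%N w ->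
      (0 < word_prob X w)%E) ->
    forall s t : R, 0 <= s <= 1 -> 0 <= t <= 1 -> s < t -> (F s < F t)%E).
Proof.
move=> F.
have incrP (x : R) : 0 <= x <= 1 -> strictly_increasing_at F x <->
    forall n : nat, (0 < n)%N ->
      (~ base_fractions q x ->
        forall xs : nat -> nat, (forall i, xs i < q)%N -> x = base_real R q xs ->
        (0 < word_prob X (mkseq xs n))%E) /\
      (forall (u : seq nat) (a : nat), is_base_fraction q x (rcons u a) ->
        (0 < word_prob X (rcons u a ++ nseq n 0%N) +
             word_prob X (rcons u a.-1 ++ nseq n q.-1))%E).
  move=> x01; split=> [Fx n _|px].
    split=> [xQ xs xsq xE|u a xf]; first exact: (increasing_nonfraction hq hXq _ Fx).
    exact: (increasing_fraction hq hXq _ Fx).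
  have [[w xw]|xQ] := pselect (base_fractions q x).
    (* The empty word is excluded because its [last] takes the default value 0. *)
    case/lastP: w xw => [[]//|u a xw].
    by apply: (fraction_increasing hq hXq xw) => n n0; apply: (px n n0).2.
  have [xs xsq xE] := base_real_surj hq x01.
  by apply: (nonfraction_increasing hq hXq xsq xE) => n n0; apply: (px n n0).1.
split=> // pw s t /andP[s0 s1] /andP[t0 t1] st.
(* Strict increase at one point between [s] and [t] already separates [F s] from [F t]. *)
suff : strictly_increasing_at F ((s + t) / 2) by apply; lra.
apply/incrP; first lra.
move=> n n0; split=> [_ xs xsq _|u a xf].
  by apply: pw; rewrite ?size_mkseq// all_mkseq_lt.
have [_ wq _ _ _] := base_fraction_words hq n xf.
apply: (@lt_le_trans _ _ (word_prob X (rcons u a ++ nseq n 0%N))).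
  by apply: pw => //; rewrite size_cat size_rcons.
by rewrite leeDl.
Qed.
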